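(* Let $p$ be a prime, let $F=\mathbb{F}_p^{ac}$ be an algebraic closure of $\mathbb{F}_p$ and let $K=\mathbb{Q}^{ac}$ be an algebraic closure of $\mathbb{Q}$. Then there is a unique injective character from $F$ to $K$ up to isomorphism; that is, an injective character $F\to K$ exists, and for any two injective characters $\chi_1,\chi_2:F\to K$ the structures $(F,K;\chi_1)$ and $(F,K;\chi_2)$ are isomorphic as $L$-structures.
   Context: A character $\chi:F\to K$ between integral domains is a map with $\chi(ab)=\chi(a)\chi(b)$ for all $a,b\in F$, $\chi(0)=0$ and $\chi(1)=1$. A structure $(F,K;\chi)$ of this kind is a structure in the $2$-sorted language $L$, which consists of two disjoint copies of the language of rings (one for each sort) augmented by a unary function symbol $\chi$ from the first sort to the second. *)

(* Defs.v *)
From HB Require Import structures.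
From mathcomp Require Import all_boot all_order all_algebra all_field.

Set Implicit Arguments.
Unset Strict Implicit.
Unset Printing Implicit Defensive.

Import GRing.Theory.
Local Open Scope ring_scope.

Definition is_character (F K : idomainType) (chi : F -> K) : Prop :=
  [/\ {morph chi : a b / a * b}, chi 0 = 0 & chi 1 = 1].

(* An isomorphism of two-sorted structures is one bijection per sort; the ring
   morphisms carry preservation of 0, 1, +, - and * on each sort, and the last
   clause is preservation of the function symbol between the sorts. *)
Definition character_isomorphic (F K F' K' : idomainType)
    (chi : F -> K) (chi' : F' -> K') : Prop :=
  exists (sigma : {rmorphism F -> F'}) (tau : {rmorphism K -> K'}),
    [/\ bijective sigma, bijective tau
      & forall a : F, tau (chi a) = chi' (sigma a)].

Definition is_algebraic_closure (k : fieldType) (E : closedFieldType)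
    (iota : {rmorphism k -> E}) : Prop :=
  forall x : E, algebraicOver iota x.

(* Main.v *)
Require Import Defs.
From HB Require Import structures.
From mathcomp Require Import all_boot all_order all_algebra all_field.
From mathcomp Require Import boolp classical_sets filter.

Set Implicit Arguments.
Unset Strict Implicit.
Unset Printing Implicit Defensive.

Import GRing.Theory.
Local Open Scope ring_scope.

(** Every nonzero element of [F] is a root of unity of order prime to [p], and
    [F] contains a primitive [m]-th root of unity exactly when [p] does not
    divide [m]. So an injective character is determined by, for every such
    [m], an isomorphism between the (cyclic) groups of [m]-th roots of unity of
    [F] and [K], in a compatible way.

    Uniqueness comes from the irreducibility of the cyclotomic polynomials over
    the rationals: two injective characters send a primitive [m]-th root of
    unity [z] to two primitive [m]-th roots of unity, which are conjugate, so
    some automorphism of [K] carries the first character to the second on the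
    [m]-th roots of unity ([conjugate_on_unity_roots]). The isomorphism can thus
    be taken to be the identity on [F].

    What remains, for existence and for uniqueness, is to pass from finite
    levels to the whole field. No coherent choice over the levels is ever made:
    [finite_choice_compactness] extracts, from solutions on all finite sets of
    arguments, a global solution, as long as each argument has only finitely
    many candidate values. The candidates are roots of a fixed polynomial:
    ['X^n - 1] for the value of a character at a root of unity of order [n], and
    the minimal polynomial over the rationals for the value of a field
    embedding.

    The same principle embeds the algebraic numbers [algC] into [K], and such an
    embedding is onto since [K] is algebraic over the rationals; hence the
    argument may be carried out in [algC], where the automorphisms of
    cyclotomic fields are known to extend. *)

(** * Compactness for functions with finitely many candidate values *)

(** Tychonoff's theorem for a product of finite sets, in the form of Rado's
    selection principle: [g] is the limit of the local solutions along an
    ultrafilter on the finite lists ordered by inclusion. At each argument the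
    solutions take finitely many values, so exactly one value is taken
    ultrafilter-often. The global function is not claimed to satisfy [P]; it
    agrees, on any finite list, with a solution for some larger list, which is
    enough to transfer any identity between finitely many values. *)
Lemma finite_choice_compactness (A B : eqType) (vals : A -> seq B)
    (P : seq A -> (A -> B) -> Prop) :
    (forall s, exists2 f, P s f & {in s, forall a, f a \in vals a}) ->
  exists g : A -> B, forall s : seq A, exists (t : seq A) (f : A -> B),
    [/\ {subset s <= t}, P t f & {in s, f =1 g}].
Proof.
move=> locP.
have {locP} /choice[f_ f_P] s :
    exists f, P s f /\ {in s, forall a, f a \in vals a}.
  by have [f Pf fv] := locP s; exists f.
pose above (s : seq A) : set (seq A) := fun t => {subset s <= t}.
have aboveF : ProperFilter (filter_from setT above).
  apply: filter_from_proper; last by move=> s _; exists s.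
  apply: filter_from_filter; first by exists [::].
  move=> s t _ _; exists (s ++ t) => // u stu; split=> x xs; apply: stu.
    by rewrite mem_cat xs.
  by rewrite mem_cat xs orbT.
have [U [Uultra subU]] := ultraFilterLemma aboveF.
have Uabove s : U (above s) by apply: subU; exists s.
have /choice[g gU] a : exists b, U (fun t => f_ t a = b).
  have : U (fun t => f_ t a \in vals a).
    apply: filterS (Uabove [:: a]) => t ta.
    by apply: (f_P t).2; apply: ta; rewrite mem_head.
  (* An ultrafilter that contains a finite union contains one of its terms. *)
  elim: (vals a) => [|b l IHl] Ul; first by have [] := filter_ex Ul.
  have [Ub|Unb] := in_ultra_setVsetC (fun t => f_ t a = b) Uultra.
    by exists b.
  apply: IHl; apply: filterS (filterI Ul Unb) => t [].
  by rewrite inE => /predU1P[].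
exists g => s.
have Ug : U (fun t => {in s, f_ t =1 g}).
  elim: s => [|a s IHs]; first by apply: filterS (Uabove [::]).
  apply: filterS (filterI (gU a) IHs) => t [fa fs] x.
  by rewrite inE => /predU1P[->|/fs].
have [t [st ft]] := filter_ex (filterI (Uabove s) Ug).
by exists t, (f_ t); split=> //; apply: (f_P t).1.
Qed.

(** * Roots of unity *)

Lemma finite_roots (L : closedFieldType) (q : {poly L}) :
  q != 0 -> {s : seq L | root q =i s}.
Proof.
move=> q0; have [s qs] := closed_field_poly_normal q; exists s => x.
by rewrite -topredE /= qs rootZ ?root_prod_XsubC // lead_coef_eq0.
Qed.

Lemma prim_root_exists (L : closedFieldType) m :
  m%:R != 0 :> L -> exists z : L, m.-primitive_root z.
Proof.
move=> nz_m; have m_gt0 : (0 < m)%N by case: m nz_m => //; rewrite eqxx.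
have [r Dp] := closed_field_poly_normal ('X^m - 1 : {poly L}).
rewrite (monicP _) ?monicXnsubC // scale1r in Dp.
have rm1: all m.-unity_root r by apply/allP=> z; rewrite -root_prod_XsubC -Dp.
have sz_r: (m < (size r).+1)%N.
  by rewrite -(size_prod_XsubC r id) -Dp size_XnsubC.
have [|z] := hasP (cyclic.has_prim_root m_gt0 rm1 _ sz_r); last by exists z.
by rewrite -separable_prod_XsubC -Dp separable_Xn_sub_1.
Qed.

(** The powers of [a] modulo a polynomial that kills it live in a finite space,
    so two of them agree and [a] has finite order. The conclusion is about the
    exact order, and not some exponent, because the exact order is automatically
    invertible in [E], that is, prime to the characteristic. *)
Lemma algebraic_prim_root (k : finFieldType) (E : fieldType)
    (iota : {rmorphism k -> E}) (a : E) :
  algebraicOver iota a -> a != 0 -> exists m, m.-primitive_root a.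
Proof.
case=> q nz_q qa0 nz_a.
pose red (i : 'I_#|{: 'rV[k]_(size q)}|.+1) : 'rV[k]_(size q) :=
  poly_rV ('X^i %% q).
have /injectivePn[i [j neq_ij eq_red]] : ~~ injectiveb red.
  by apply/injectiveP => /leq_card; rewrite card_ord ltnn.
have eq_mod : 'X^i %% q = 'X^j %% q.
  have modK l : rVpoly (poly_rV ('X^l %% q) : 'rV[k]_(size q)) = 'X^l %% q.
    by rewrite poly_rV_K // ltnW // ltn_modp.
  by rewrite -modK -[RHS]modK; congr rVpoly.
have eq_pow : a ^+ i = a ^+ j.
  have modE l : (map_poly iota ('X^l %% q)).[a] = a ^+ l.
    have := congr1 (fun p => (map_poly iota p).[a]) (divp_eq 'X^l q).
    rewrite rmorphD rmorphM /= hornerD hornerM (eqP qa0) mulr0 add0r.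
    by rewrite map_polyXn hornerXn.
  by rewrite -modE eq_mod modE.
wlog lt_ij : i j neq_ij eq_red eq_mod eq_pow / (i < j)%N.
  move=> IH; have [|le_ji] := ltnP i j; first exact: IH.
  by apply: (IH j i); rewrite 1?eq_sym // ltn_neqAle eq_sym le_ji andbT.
have a1 : a ^+ (j - i) = 1.
  apply: (mulfI (expf_neq0 i nz_a)).
  by rewrite -exprD subnKC 1?ltnW // mulr1.
by have [|m ? _] := prim_order_exists _ a1; [rewrite subn_gt0 | exists m].
Qed.

(** * Embedding the algebraic numbers *)

Lemma rmorphism_of (R S : pzRingType) (f : R -> S) :
    GRing.zmod_morphism f -> GRing.monoid_morphism f ->
  exists g : {rmorphism R -> S}, g =1 f.
Proof.
move=> fB fM.
pose g : {rmorphism R -> S} := HB.pack f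
  (GRing.isZmodMorphism.Build R S f fB) (GRing.isMonoidMorphism.Build R S f fM).
by exists g.
Qed.

Lemma rmorphism_inverse (R S : fieldType) (f : {rmorphism R -> S}) :
    (forall y, exists x, f x = y) ->
  exists g : {rmorphism S -> R}, cancel f g /\ cancel g f.
Proof.
move=> f_surj.
have [h hK] := choice f_surj.
have fK : cancel f h by move=> x; apply: (fmorph_inj f); rewrite hK.
have [|g gE] := rmorphism_of (f := h) (can2_zmod_morphism fK hK).
  exact: (can2_monoid_morphism fK hK).
by exists g; split=> x; rewrite gE.
Qed.

(** The image of an embedding of [algC] contains all the roots of every
    rational polynomial, because such a polynomial already splits in [algC]. *)
Lemma algC_embedding_surj (E : fieldType) (iota : {rmorphism rat -> E})
    (alg : forall y, algebraicOver iota y) (f : {rmorphism algC -> E}) y :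
  exists x, f x = y.
Proof.
have [q nz_q qy0] := alg y.
have nz_qC : map_poly ratr q != 0 :> {poly algC} by rewrite map_poly_eq0.
have [r Dq] := closed_field_poly_normal (map_poly ratr q : {poly algC}).
have qE : map_poly iota q = map_poly f (map_poly ratr q).
  rewrite -map_poly_comp; apply: eq_map_poly => c /=.
  by rewrite fmorph_rat fmorph_eq_rat.
move: qy0; rewrite qE Dq map_polyZ rootZ ?fmorph_eq0 ?lead_coef_eq0 //.
rewrite rmorph_prod (eq_bigr (fun x => 'X - (f x)%:P)) => [|x _]; last first.
  by rewrite rmorphB /= map_polyX map_polyC.
by rewrite -(big_map f xpredT (fun x => 'X - x%:P)) root_prod_XsubC
  => /mapP[x _ ->]; exists x.
Qed.

Local Notation pQtoC := (map_poly (ratr : rat -> algC)).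

(** A finite list of algebraic numbers lies in some number field generated by
    one element [z], and sending [z] to a root [w] in [L] of its minimal
    polynomial maps this number field to [L]. Compactness glues these maps; the
    values at [x] stay among the roots of the minimal polynomial of [x]. *)
Lemma algC_embedding (L : closedFieldType) (iota : {rmorphism rat -> L}) :
  inhabited {rmorphism algC -> L}.
Proof.
pose conjugate (z : algC) (w : L) := forall p : {poly rat},
  root (pQtoC p) z -> root (map_poly iota p) w.
pose specialization (t : seq algC) (f : algC -> L) :=
  exists z w, conjugate z w /\ {in t, forall x, exists2 p,
    x = (pQtoC p).[z] & f x = (map_poly iota p).[w]}.
have [vals valsP] : exists vals : algC -> seq L, forall x y,
    conjugate x y -> y \in vals x.
  have /choice[vals valsP] x : exists s : seq L, forall y,
      conjugate x y -> y \in s.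
    have [q [_ mon_q] qx] := minCpolyP x.
    have nz_q : map_poly iota q != 0 by rewrite map_poly_eq0 monic_neq0.
    have [s sP] := finite_roots nz_q; exists s => y xy.
    by rewrite -sP; apply: xy; rewrite qx.
  by exists vals.
have loc s : exists2 f, specialization s f & {in s, forall x, f x \in vals x}.
  have [z _ [ps Ds]] := algC_PET s.
  have [r [Dr mon_r] dv_r] := minCpolyP z.
  have size_r : size (map_poly iota r) != 1.
    rewrite size_map_poly -(size_map_poly (ratr : {rmorphism rat -> algC})) -Dr.
    by rewrite gtn_eqF // size_minCpoly.
  have [w rw] := closed_rootP _ size_r.
  have zw : conjugate z w.
    move=> p; rewrite dv_r => /dvdpP[q ->].
    by rewrite rmorphM rootM rw orbT.
  pose f x := (map_poly iota (nth 0 ps (index x s))).[w].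
  have fP : {in s, forall x, exists2 p, x = (pQtoC p).[z]
      & f x = (map_poly iota p).[w]}.
    move=> x xs; exists (nth 0 ps (index x s)) => //.
    rewrite -[LHS](nth_index 0 xs) {1}Ds (nth_map 0) //.
    by rewrite -(size_map (fun p => (pQtoC p).[z])) -Ds index_mem.
  exists f; first by exists z, w.
  move=> x /fP[p -> ->]; apply: valsP => q.
  (* [q] kills [p(z)] iff the composite of [q] with [p] kills [z]. *)
  rewrite /root -!horner_comp -!map_comp_poly; exact: zw.
have [g gP] := finite_choice_compactness loc.
have gB : GRing.zmod_morphism g.
  move=> x y; have [t [f [st [z [w [zw fP]]] gf]]] := gP [:: x; y; x - y].
  rewrite -!gf ?inE ?eqxx ?orbT //.
  have [|px xE ->] := fP x; rewrite ?st ?inE ?eqxx //.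
  have [|py yE ->] := fP y; rewrite ?st ?inE ?eqxx ?orbT //.
  have [|pz zE ->] := fP (x - y); rewrite ?st ?inE ?eqxx ?orbT //.
  have := zw (pz - (px - py)); rewrite /root !rmorphB !hornerE -xE -yE -zE.
  by rewrite subrr eqxx => /(_ isT); rewrite subr_eq0 => /eqP.
have gM : GRing.monoid_morphism g.
  split.
    have [t [f [st [z [w [zw fP]]] gf]]] := gP [:: 1].
    rewrite -!gf ?inE ?eqxx ?orbT //.
    have [|p pE ->] := fP 1; rewrite ?st ?inE ?eqxx //.
    have := zw (p - 1); rewrite /root !rmorphB !rmorph1 !hornerE -pE.
    by rewrite subrr eqxx => /(_ isT); rewrite subr_eq0 => /eqP.
  move=> x y; have [t [f [st [z [w [zw fP]]] gf]]] := gP [:: x; y; x * y].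
  rewrite -!gf ?inE ?eqxx ?orbT //.
  have [|px xE ->] := fP x; rewrite ?st ?inE ?eqxx //.
  have [|py yE ->] := fP y; rewrite ?st ?inE ?eqxx ?orbT //.
  have [|pz zE ->] := fP (x * y); rewrite ?st ?inE ?eqxx ?orbT //.
  have := zw (pz - px * py).
  rewrite /root !rmorphB !rmorphM !hornerE -xE -yE -zE.
  by rewrite subrr eqxx => /(_ isT); rewrite subr_eq0 => /eqP.
by have [f _] := rmorphism_of gB gM; constructor.
Qed.

(** * Characters on finite sets of roots of unity *)

Lemma characterX (F K : idomainType) (chi : F -> K) a n :
  is_character chi -> chi (a ^+ n) = chi a ^+ n.
Proof.
case=> chiM _ chi1; elim: n => [|n IHn]; first by rewrite !expr0.
by rewrite !exprS chiM IHn.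
Qed.

Lemma character_prim_root (F K : idomainType) (chi : F -> K) m z :
    is_character chi -> injective chi -> m.-primitive_root z ->
  m.-primitive_root (chi z).
Proof.
move=> chiP chi_inj prim_z; have [_ _ chi1] := chiP.
have [|k prim_k dv_k] := prim_order_exists (prim_order_gt0 prim_z) (z := chi z).
  by rewrite -characterX // prim_expr_order.
suffices /eqP <- : k == m by [].
rewrite eqn_dvd dv_k (prim_order_dvd prim_z); apply/eqP/chi_inj.
by rewrite characterX // chi1 prim_expr_order.
Qed.

Lemma character_comp (F : idomainType) (K K' : fieldType)
    (f : {rmorphism K -> K'}) (chi : F -> K) :
    is_character chi -> injective chi ->
  is_character (f \o chi) /\ injective (f \o chi).
Proof.
move=> [chiM chi0 chi1] chi_inj; split; last exact: inj_comp (fmorph_inj f) _.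
split=> [a b||] /=; first by rewrite chiM rmorphM.
  by rewrite chi0 rmorph0.
by rewrite chi1 rmorph1.
Qed.

(** Allowing an injection [chi] lets the same lemma serve for lists of elements
    of [F] and for lists in the target of a character. *)
Lemma common_exponent (F : fieldType) (T : eqType) (chi : F -> T) (s : seq T) :
    (forall a : F, a != 0 -> exists m, m.-primitive_root a) -> injective chi ->
  exists2 m, m%:R != 0 :> F
    & forall a, chi a \in s -> a = 0 \/ a ^+ m = 1.
Proof.
move=> prim chi_inj; elim: s => [|x s [m nz_m mP]].
  by exists 1%N; rewrite ?oner_neq0.
have [[a [nz_a ax]]|no_a] := pselect (exists a, a != 0 /\ chi a = x).
  have [k prim_a] := prim a nz_a.
  exists (k * m)%N => [|b].
    by rewrite natrM mulf_neq0 // (prim_root_natf_neq0 prim_a).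
  rewrite inE => /predU1P[|/mP[]]; [|by left|].
    rewrite -ax => /chi_inj->; right.
    by rewrite exprM (prim_expr_order prim_a) expr1n.
  by move=> bm; right; rewrite mulnC exprM bm expr1n.
exists m => // b; rewrite inE => /predU1P[bx|/mP//].
by have [->|nz_b] := eqVneq b 0; [left | case: no_a; exists b].
Qed.

(** Both images of a primitive [m]-th root of unity are primitive, so one is a
    power of the other with exponent prime to [m]; raising the [m]-th roots of
    unity to that power is a field automorphism since the cyclotomic polynomial
    is irreducible over the rationals. *)
Lemma conjugate_on_unity_roots (F : closedFieldType)
    (chi1 chi2 : F -> algC) m :
    is_character chi1 -> injective chi1 ->
    is_character chi2 -> injective chi2 -> m%:R != 0 :> F ->
  exists u : {rmorphism algC -> algC},
    forall a, a ^+ m = 1 -> u (chi1 a) = chi2 a.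
Proof.
move=> ch1 inj1 ch2 inj2 /prim_root_exists[z prim_z].
have prim1 := character_prim_root ch1 inj1 prim_z.
have prim2 := character_prim_root ch2 inj2 prim_z.
have [k chi2z] := prim_rootP prim1 (prim_expr_order prim2).
have co_k : coprime k m by rewrite -(prim_root_exp_coprime _ prim1) -chi2z.
have [u uP] := Qn_aut_exists co_k.
exists u => a /(prim_rootP prim_z)[i ->].
rewrite (characterX _ _ ch1) (characterX _ _ ch2) rmorphXn /= uP.
  by rewrite -chi2z.
exact: prim_expr_order prim1.
Qed.

(** * Uniqueness and existence over the algebraic numbers *)

(** An automorphism preserves minimal polynomials, which leaves finitely many
    candidates at each algebraic number. The solutions for lists of algebraic
    numbers are automorphisms that match the two characters wherever the first
    one takes a listed value. *)
Lemma algC_characters_conjugate (F : closedFieldType)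
    (primF : forall a : F, a != 0 -> exists m, m.-primitive_root a)
    (chi1 chi2 : F -> algC) :
    is_character chi1 -> injective chi1 ->
    is_character chi2 -> injective chi2 ->
  exists u : {rmorphism algC -> algC}, forall a, u (chi1 a) = chi2 a.
Proof.
move=> ch1 inj1 ch2 inj2.
pose vals (x : algC) : seq algC := sval (finite_roots (negbT (minCpoly_eq0 x))).
pose intertwines (t : seq algC) (f : algC -> algC) :=
  exists2 u : {rmorphism algC -> algC}, f = u
    & forall a, chi1 a \in t -> u (chi1 a) = chi2 a.
have loc s : exists2 f, intertwines s f & {in s, forall x, f x \in vals x}.
  have [m nz_m mP] := common_exponent s primF inj1.
  have [u uP] := conjugate_on_unity_roots ch1 inj1 ch2 inj2 nz_m.
  exists u.
    exists u => // a /mP[->|/uP//].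
    by case: ch1 ch2 => _ -> _ [_ -> _]; rewrite rmorph0.
  move=> x _; rewrite /vals; case: finite_roots => /= l <-.
  rewrite -(minCpoly_aut u); exact: root_minCpoly.
have [g gP] := finite_choice_compactness loc.
have gB : GRing.zmod_morphism g.
  move=> x y; have [t [_ [_ [u -> _] gu]]] := gP [:: x; y; x - y].
  by rewrite -!gu ?inE ?eqxx ?orbT // rmorphB.
have gM : GRing.monoid_morphism g.
  split=> [|x y].
    have [t [_ [_ [u -> _] gu]]] := gP [:: 1].
    by rewrite -!gu ?inE // rmorph1.
  have [t [_ [_ [u -> _] gu]]] := gP [:: x; y; x * y].
  by rewrite -!gu ?inE ?eqxx ?orbT // rmorphM.
have [u uE] := rmorphism_of gB gM; exists u => a.
have [t [_ [st [v -> vP] gv]]] := gP [:: chi1 a].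
by rewrite uE -gv ?vP ?st ?mem_head.
Qed.

(** The axioms of an injective character, only on the submonoid formed by zero
    and the [m]-th roots of unity. *)
Definition partial_character (F : closedFieldType) m (chi : F -> algC) :=
  let D a := a = 0 \/ a ^+ m = 1 in
  [/\ chi 0 = 0, chi 1 = 1,
      forall a b, D a -> D b -> chi (a * b) = chi a * chi b
    & forall a b, D a -> D b -> chi a = chi b -> a = b].

Lemma partial_character_exists (F : closedFieldType) m :
  m%:R != 0 :> F -> exists chi : F -> algC, partial_character m chi.
Proof.
move=> nz_m; have [z prim_z] := prim_root_exists nz_m.
have m_gt0 := prim_order_gt0 prim_z.
have [w prim_w] := C_prim_root_exists m_gt0.
pose chi a := if [pick i : 'I_m | a == z ^+ i] is Some i then w ^+ i else 0.
have chiE i : chi (z ^+ i) = w ^+ i.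
  rewrite /chi; case: pickP => [j|/(_ (Ordinal (ltn_pmod i m_gt0)))/=].
    rewrite (eq_prim_root_expr prim_z) -(eq_prim_root_expr prim_w).
    by move=> /eqP ->.
  by rewrite prim_expr_mod // eqxx.
have chi0 : chi 0 = 0.
  rewrite /chi; case: pickP => // i; rewrite eq_sym expf_eq0.
  by rewrite (prim_root_eq0 prim_z) gtn_eqF ?andbF.
have nz_w i : w ^+ i != 0.
  by rewrite expf_neq0 // (prim_root_eq0 prim_w) gtn_eqF.
exists chi; split=> //.
- by rewrite -(expr0 z) chiE.
- move=> a b [->|/(prim_rootP prim_z)[i ->]].
    by rewrite !mul0r chi0 mul0r.
  case=> [->|/(prim_rootP prim_z)[j ->]]; first by rewrite !mulr0 chi0 mulr0.
  by rewrite -exprD !chiE exprD.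
- move=> a b [->|/(prim_rootP prim_z)[i ->]].
    case=> [->//|/(prim_rootP prim_z)[j ->]].
    by rewrite chi0 chiE => /esym/eqP; rewrite (negPf (nz_w j)).
  case=> [->|/(prim_rootP prim_z)[j ->]].
    by rewrite chi0 chiE => /eqP; rewrite (negPf (nz_w i)).
  rewrite !chiE => /eqP; rewrite (eq_prim_root_expr prim_w).
  by rewrite -(eq_prim_root_expr prim_z) => /eqP.
Qed.

Lemma partial_characterX (F : closedFieldType) m (chi : F -> algC) a n :
  partial_character m chi -> a ^+ m = 1 -> chi (a ^+ n) = chi a ^+ n.
Proof.
move=> [_ chi1 chiM _] am; elim: n => [|n IHn]; first by rewrite !expr0.
by rewrite !exprS chiM ?IHn //; right; rewrite // -exprM mulnC exprM am expr1n.
Qed.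

(** A partial character sends a root of unity of order [n] to an [n]-th root of
    unity, whatever its level [m] is: this gives the candidates needed to glue
    the partial characters of all levels. *)
Lemma algC_character_exists (F : closedFieldType)
    (primF : forall a : F, a != 0 -> exists m, m.-primitive_root a) :
  exists2 chi : F -> algC, is_character chi & injective chi.
Proof.
have [vals valsP] : exists vals : F -> seq algC, forall a m chi,
    partial_character m chi -> a = 0 \/ a ^+ m = 1 -> chi a \in vals a.
  have /choice[vals valsP] (a : F) : exists s : seq algC, forall m chi,
      partial_character m chi -> a = 0 \/ a ^+ m = 1 -> chi a \in s.
    have [->|/primF[n prim_a]] := eqVneq a 0.
      by exists [:: 0] => m chi [-> _ _ _] _; rewrite mem_head.
    have n_gt0 := prim_order_gt0 prim_a.
    have nz_p : 'X^n - 1 != 0 :> {poly algC} by rewrite monic_neq0 ?monicXnsubC.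
    have [s sP] := finite_roots nz_p; exists s => m chi chiP [a0|am].
      by move: (prim_root_eq0 prim_a); rewrite a0 eqxx gtn_eqF.
    rewrite -sP -topredE /= -[root _ _]/(n.-unity_root _) unity_rootE.
    rewrite -(partial_characterX _ chiP am) (prim_expr_order prim_a).
    by case: chiP => _ -> _ _.
  by exists vals.
pose extends (t : seq F) (chi : F -> algC) := exists2 m, partial_character m chi
  & forall a, a \in t -> a = 0 \/ a ^+ m = 1.
have loc s : exists2 chi, extends s chi & {in s, forall a, chi a \in vals a}.
  have [m nz_m mP] := common_exponent s primF (@inj_id F).
  have [chi chiP] := partial_character_exists nz_m.
  by exists chi; [exists m | move=> a /mP; apply: valsP].
have [g gP] := finite_choice_compactness loc; exists g.
  split=> [a b||].
  - have [t [f [st [m [_ _ fM _] mP] gf]]] := gP [:: a; b; a * b].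
    rewrite -!gf ?inE ?eqxx ?orbT // fM //; apply/mP/st.
      by rewrite mem_head.
    by rewrite !inE eqxx orbT.
  - have [t [f [st [m [f0 _ _ _] mP] gf]]] := gP [:: 0].
    by rewrite -gf ?mem_head.
  - have [t [f [st [m [_ f1 _ _] mP] gf]]] := gP [:: 1].
    by rewrite -gf ?mem_head.
move=> a b; have [t [f [st [m [_ _ _ f_inj] mP] gf]]] := gP [:: a; b].
rewrite -!gf ?inE ?eqxx ?orbT //; apply: f_inj; apply/mP/st.
  by rewrite mem_head.
by rewrite !inE eqxx orbT.
Qed.

(** * Arbitrary algebraic closures *)

Theorem corollary3p2 (p : nat) (p_prime : prime p)
    (F : closedFieldType) (iotaF : {rmorphism 'F_p -> F})
    (hF : is_algebraic_closure iotaF)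
    (K : closedFieldType) (iotaK : {rmorphism rat -> K})
    (hK : is_algebraic_closure iotaK) :
  (exists chi : F -> K, is_character chi /\ injective chi) /\
  (forall chi1 chi2 : F -> K,
     is_character chi1 -> injective chi1 ->
     is_character chi2 -> injective chi2 ->
     character_isomorphic chi1 chi2).
Proof.
have primF (a : F) : a != 0 -> exists m, m.-primitive_root a.
  exact: algebraic_prim_root (hF a).
have [f] := algC_embedding iotaK.
have [g [fK gK]] := rmorphism_inverse (algC_embedding_surj hK f).
split=> [|chi1 chi2 ch1 inj1 ch2 inj2].
  have [chi chP chi_inj] := algC_character_exists primF.
  by exists (f \o chi); apply: character_comp.
have [gch1 ginj1] := character_comp g ch1 inj1.
have [gch2 ginj2] := character_comp g ch2 inj2.
have [u uP] := algC_characters_conjugate primF gch1 ginj1 gch2 ginj2.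
have alg_algC x : algebraicOver (ratr : {rmorphism rat -> algC}) x.
  have [q [_ mon_q] qx] := minCpolyP x.
  by exists q; rewrite ?monic_neq0 ?qx.
have [v [uK vK]] := rmorphism_inverse (algC_embedding_surj alg_algC u).
(* On the first sort nothing needs to move: all the adjustment is made by a
   Galois automorphism of the target. *)
exists idfun, (f \o u \o g : {rmorphism K -> K}); split=> [||a].
- by exists id.
- exists (f \o v \o g) => x /=; first by rewrite fK uK gK.
  by rewrite fK vK gK.
- by rewrite /= [u _]uP /= gK.
Qed.
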